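(* Let $u_i\in\mathcal{U}$ and $\mathcal{Y}_a\subseteq\mathcal{Y}$ be the attacked actuator and the (unprotected) attacked sensors, respectively. If the Type 3 attacker can attack $u_i$ and ensure the attack remains perfectly undetectable, then $|\mathcal{Y}_a|\ge\delta_r(u_i)-1$. If $\delta_r(u_i)=+\infty$, the Type 3 attacker cannot attack $u_i$ and ensure the attack remains perfectly undetectable.
   Context: System. For real matrices $A\in\mathbb{R}^{n_x\times n_x}$, $B\in\mathbb{R}^{n_x\times n_u}$, $C\in\mathbb{R}^{(n_y+n_e)\times n_x}$, consider, for $k\in\mathbb{Z}_{\ge0}$, $x(k+1)=Ax(k)+Bu(k)+B_a a(k)$, $y(k)=Cx(k)+D_a a(k)$, with $x(0)=0$ and $u=0$, where $$B_a=\begin{bmatrix} B & \mathbf{0}_{n_x\times n_y}\end{bmatrix},\qquad D_a=\begin{bmatrix}\mathbf{0}_{n_y\times n_u} & \mathbf{I}_{n_y}\\ \mathbf{0}_{n_e\times n_u} & \mathbf{0}_{n_e\times n_y}\end{bmatrix}.$$ The first $n_u$ entries $a^{(u_j)}$ of the attack $a(k)\in\mathbb{R}^{n_u+n_y}$ act on the actuators $u_1,\dots,u_{n_u}$ and the last $n_y$ entries on the unprotected sensors $y_1,\dots,y_{n_y}$; sensors $y_{n_y+1},\dots,y_{n_y+n_e}$ are protected and cannot be attacked. An attack $a\neq0$ is perfectly undetectable if $y(k)=0$ for all $k$. Structural model. $[A],[B],[C]$ are binary matrices of the same sizes as $A,B,C$. A realization is a triple of real matrices $A,B,C$ whose entries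 are $0$ wherever the corresponding structural entry is $0$, and arbitrary real numbers where it is $1$, subject to the standing assumption ($e_i$ canonical basis vectors): (1) $[B]=[e_{i_1}\cdots e_{i_{n_u}}]$; (2) $[B]$ has full column rank; (3) if $[B](i,j)=1$ then $B(i,j)\neq0$ in every realization; (4) $[C]=[e_{j_1}\cdots e_{j_{n_y+n_e}}]^T$. Graph. $\mathcal{X}=\{x_1,\dots,x_{n_x}\}$, $\mathcal{U}=\{u_1,\dots,u_{n_u}\}$, $\mathcal{Y}=\{y_1,\dots,y_{n_y+n_e}\}$. $\mathcal{E}_{ux}=\{(u_j,x_i):[B](i,j)\ne0\}$, $\mathcal{E}_{xx}=\{(x_j,x_i):[A](i,j)\neq0\}$, $\mathcal{E}_{xy}=\{(x_j,y_i):[C](i,j)\ne0\}$. The extended graph $\mathcal{G}_t$ is the directed graph with nodes $\mathcal{X}\cup\mathcal{U}\cup\mathcal{Y}\cup\{t\}$ and edges $\mathcal{E}_{ux}\cup\mathcal{E}_{xx}\cup\mathcal{E}_{xy}\cup\{(y_i,t):y_i\in\mathcal{Y}\}$. A vertex separator of non-adjacent nodes $v_a,v_b$ is a set of nodes not containing $v_a,v_b$ whose removal deletes all directed paths from $v_a$ to $v_b$. Robust security index. $\delta_r(u_i)$ is the minimum of $|\mathcal{U}'|+|\mathcal{Y}'|$ over $\mathcal{U}'\subseteq\mathcal{U}$, $\mathcal{Y}'\subseteq\mathcal{Y}$ such that $u_i\in\mathcal{U}'$, all sensors in $\mathcal{Y}'$ are unprotected, and $\mathcal{X}'\cup\mathcal{Y}'$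 is a vertex separator of $u_i$ and $t$ in $\mathcal{G}_t$, where $\mathcal{X}'=\{x_j:(u_k,x_j)\in\mathcal{E}_{ux},\ u_k\in\mathcal{U}'\setminus\{u_i\}\}$. If no such pair exists, $\delta_r(u_i)=+\infty$. Type 3 attacker. The attacker: (1) can read and change the values of the attacked control signals and measurements (here $u_i$ and $\mathcal{Y}_a$) arbitrarily; (2) knows only $[A],[B],[C]$ (not the realization); (3) wants to ensure that the attack remains perfectly undetectable. Thus an attack is given by a policy in which $a(k)$ is supported on $\{u_i\}\cup\mathcal{Y}_a$ and is a function only of $k$, $[A],[B],[C]$, and the unaltered measurements $C(l,:)x$ of the attacked sensors $y_l\in\mathcal{Y}_a$ at times up to $k$. ''Can attack $u_i$ and ensure the attack remains perfectly undetectable'' means that there is such a policy for which, in every realization $A,B,C$, the resulting attack has $a^{(u_i)}(k)\neq0$ for at least one $k$ and is perfectly undetectable. *)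

(* Defs.v *)
(* The reals are an arbitrary [R : realType]. *)
From mathcomp Require Import all_boot all_order all_algebra.
From mathcomp Require Import reals constructive_ereal.

Set Implicit Arguments.
Unset Strict Implicit.
Unset Printing Implicit Defensive.

Import Order.TTheory GRing.Theory Num.Theory.
Local Open Scope ring_scope.

(* Indices are 0-based: the sensors are 'I_(ny + ne), and sensor l is
   unprotected when l < ny, i.e. when it is [lshift ne l'] for some l' : 'I_ny.
   Likewise 'I_(nu + ny) indexes the entries of an attack vector: [lshift ny j]
   is the entry acting on actuator j, [rshift nu l] the one acting on
   unprotected sensor l. *)

Definition unprotected (ny ne : nat) (l : 'I_(ny + ne)) : bool := (l < ny)%N.

(** * The system under attack *)

Definition Ba (R : realType) (nx nu ny : nat) (B : 'M[R]_(nx, nu)) :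
  'M[R]_(nx, nu + ny) := row_mx B 0.

Definition Da (R : realType) (nu ny ne : nat) : 'M[R]_(ny + ne, nu + ny) :=
  block_mx 0 1%:M 0 0.

(* x(0) = 0 and the control input is 0, so that B u(k) vanishes. *)
Fixpoint state (R : realType) (nx nu ny : nat) (A : 'M[R]_nx)
    (B : 'M[R]_(nx, nu)) (a : nat -> 'cV[R]_(nu + ny)) (k : nat) : 'cV[R]_nx :=
  if k is k'.+1 then A *m state A B a k' + Ba ny B *m a k' else 0.

Definition output (R : realType) (nx nu ny ne : nat) (A : 'M[R]_nx)
    (B : 'M[R]_(nx, nu)) (C : 'M[R]_(ny + ne, nx))
    (a : nat -> 'cV[R]_(nu + ny)) (k : nat) : 'cV[R]_(ny + ne) :=
  C *m state A B a k + Da R nu ny ne *m a k.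

Definition perfectly_undetectable (R : realType) (nx nu ny ne : nat)
    (A : 'M[R]_nx) (B : 'M[R]_(nx, nu)) (C : 'M[R]_(ny + ne, nx))
    (a : nat -> 'cV[R]_(nu + ny)) : Prop :=
  (exists k, a k != 0) /\ (forall k, output A B C a k = 0).

(** * Structural model *)

(* Full column rank is that of the 0/1 matrix read over the reals. *)
Definition structural_assumption (R : realType) (nx nu ny ne : nat)
    (SB : 'M[bool]_(nx, nu)) (SC : 'M[bool]_(ny + ne, nx)) : Prop :=
  [/\ exists p : 'I_nu -> 'I_nx, SB = \matrix_(i, j) (i == p j),
      \rank (map_mx (fun b : bool => b%:R : R) SB) = nu
    & exists q : 'I_(ny + ne) -> 'I_nx, SC = \matrix_(i, j) (j == q i)].

Definition realization (R : realType) (nx nu ny ne : nat)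
    (SA : 'M[bool]_nx) (SB : 'M[bool]_(nx, nu)) (SC : 'M[bool]_(ny + ne, nx))
    (A : 'M[R]_nx) (B : 'M[R]_(nx, nu)) (C : 'M[R]_(ny + ne, nx)) : Prop :=
  [/\ forall i j, ~~ SA i j -> A i j = 0,
      forall i j, ~~ SB i j -> B i j = 0,
      forall i j, SB i j -> B i j != 0
    & forall i j, ~~ SC i j -> C i j = 0].

(** * Extended graph and robust security index *)

Definition node (nx nu m : nat) : finType := ('I_nx + 'I_nu + 'I_m + unit)%type.

Definition xnode (nx nu m : nat) (i : 'I_nx) : node nx nu m :=
  inl (inl (inl i)).
Definition unode (nx nu m : nat) (j : 'I_nu) : node nx nu m :=
  inl (inl (inr j)).
Definition ynode (nx nu m : nat) (l : 'I_m) : node nx nu m := inl (inr l).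
Definition tnode (nx nu m : nat) : node nx nu m := inr tt.

(* Entry (i, j) of a structural matrix is an edge from the j-th source to the
   i-th target. *)
Definition extended_graph (nx nu m : nat) (SA : 'M[bool]_nx)
    (SB : 'M[bool]_(nx, nu)) (SC : 'M[bool]_(m, nx)) : rel (node nx nu m) :=
  fun v w => match v, w with
  | inl (inl (inr j)), inl (inl (inl i)) => SB i j
  | inl (inl (inl j)), inl (inl (inl i)) => SA i j
  | inl (inl (inl j)), inl (inr l) => SC l j
  | inl (inr _), inr _ => true
  | _, _ => false
  end.

Definition remove_nodes (V : finType) (e : rel V) (S : {set V}) : rel V :=
  fun v w => [&& e v w, v \notin S & w \notin S].

Definition vertex_separator (V : finType) (e : rel V) (va vb : V)
    (S : {set V}) : bool :=
  [&& va \notin S, vb \notin S & ~~ connect (remove_nodes e S) va vb].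

Definition admissible (nx nu ny ne : nat) (SA : 'M[bool]_nx)
    (SB : 'M[bool]_(nx, nu)) (SC : 'M[bool]_(ny + ne, nx)) (i : 'I_nu)
    (P : {set 'I_nu} * {set 'I_(ny + ne)}) : bool :=
  let: (U', Y') := P in
  let X' := [set j | [exists k in U' :\ i, SB j k]] in
  [&& i \in U',
      [forall l in Y', unprotected l]
    & vertex_separator (extended_graph SA SB SC)
        (unode nx (ny + ne) i) (tnode nx nu (ny + ne))
        ([set xnode nu (ny + ne) j | j in X'] :|:
         [set ynode nx nu l | l in Y'])].

(* The default value +oo of the iterated minimum is attained exactly when no
   pair is admissible. *)
Definition robust_index (R : realType) (nx nu ny ne : nat) (SA : 'M[bool]_nx)
    (SB : 'M[bool]_(nx, nu)) (SC : 'M[bool]_(ny + ne, nx)) (i : 'I_nu) :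
    \bar R :=
  \big[mine/+oo%E]_(P : {set 'I_nu} * {set 'I_(ny + ne)}
                     | admissible SA SB SC i P)
    ((#|P.1| + #|P.2|)%N%:R)%:E.

(** * Type 3 attacker *)

(* A policy maps the time k and the readings of the attacked sensors at the
   times 0, ..., k to the attack vector at time k. *)
Definition readings (R : realType) (ny ne : nat) (Y_a : {set 'I_(ny + ne)})
    (k : nat) : Type :=
  {ffun 'I_k.+1 * {l : 'I_(ny + ne) | l \in Y_a} -> R}.

Definition policy (R : realType) (nu ny ne : nat) (Y_a : {set 'I_(ny + ne)}) :
    Type :=
  forall k : nat, readings R Y_a k -> 'cV[R]_(nu + ny).

Definition supported (R : realType) (nu ny ne : nat) (i : 'I_nu)
    (Y_a : {set 'I_(ny + ne)}) (a : 'cV[R]_(nu + ny)) : Prop :=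
  (forall j : 'I_nu, j != i -> a (lshift ny j) 0 = 0) /\
  (forall l : 'I_ny, lshift ne l \notin Y_a -> a (rshift nu l) 0 = 0).

(* The readings are the unaltered measurements C x, without Da a. *)
Definition measured (R : realType) (nx ny ne : nat) (C : 'M[R]_(ny + ne, nx))
    (Y_a : {set 'I_(ny + ne)}) (x : nat -> 'cV[R]_nx) (k : nat) :
    readings R Y_a k :=
  [ffun p : 'I_k.+1 * {l | l \in Y_a} => (C *m x p.1) (val p.2) 0].

Definition generated_by (R : realType) (nx nu ny ne : nat) (A : 'M[R]_nx)
    (B : 'M[R]_(nx, nu)) (C : 'M[R]_(ny + ne, nx)) (Y_a : {set 'I_(ny + ne)})
    (pol : policy R nu Y_a) (a : nat -> 'cV[R]_(nu + ny)) : Prop :=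
  forall k, a k = pol k (measured C Y_a (state A B a) k).

(* The policy is chosen after the structural matrices and before the
   realization: it may depend on the former only.  By [generated_by_exists] and
   [generated_by_unique] below, it generates exactly one attack in each
   realization. *)
Definition type3_can_attack (R : realType) (nx nu ny ne : nat)
    (SA : 'M[bool]_nx) (SB : 'M[bool]_(nx, nu)) (SC : 'M[bool]_(ny + ne, nx))
    (i : 'I_nu) (Y_a : {set 'I_(ny + ne)}) : Prop :=
  exists2 pol : policy R nu Y_a,
    forall k h, supported i Y_a (pol k h) &
    forall (A : 'M[R]_nx) (B : 'M[R]_(nx, nu)) (C : 'M[R]_(ny + ne, nx)),
      realization SA SB SC A B C ->
      exists a : nat -> 'cV[R]_(nu + ny),
        [/\ generated_by A B C pol a,
            exists k, a k (lshift ny i) 0 != 0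
          & perfectly_undetectable A B C a].

(* Causality: the readings up to time k only involve the attack before k. *)
Lemma eq_state (R : realType) (nx nu ny : nat) (A : 'M[R]_nx)
    (B : 'M[R]_(nx, nu)) (a b : nat -> 'cV[R]_(nu + ny)) (k : nat) :
  (forall s, (s < k)%N -> a s = b s) -> state A B a k = state A B b k.
Proof.
elim: k => //= k IHk eq_ab.
by rewrite eq_ab // IHk // => s lt_sk; apply: eq_ab; rewrite ltnW.
Qed.

Lemma eq_measured (R : realType) (nx nu ny ne : nat) (A : 'M[R]_nx)
    (B : 'M[R]_(nx, nu)) (C : 'M[R]_(ny + ne, nx)) (Y_a : {set 'I_(ny + ne)})
    (a b : nat -> 'cV[R]_(nu + ny)) (k : nat) :
  (forall s, (s < k)%N -> a s = b s) ->
  measured C Y_a (state A B a) k = measured C Y_a (state A B b) k.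
Proof.
move=> eq_ab; apply/ffunP => -[s l]; rewrite !ffunE /=.
rewrite (@eq_state _ _ _ _ _ _ a b) // => r lt_rs.
by apply: eq_ab; apply: leq_trans lt_rs _; rewrite -ltnS.
Qed.

Lemma generated_by_unique (R : realType) (nx nu ny ne : nat) (A : 'M[R]_nx)
    (B : 'M[R]_(nx, nu)) (C : 'M[R]_(ny + ne, nx)) (Y_a : {set 'I_(ny + ne)})
    (pol : policy R nu Y_a) (a b : nat -> 'cV[R]_(nu + ny)) :
  generated_by A B C pol a -> generated_by A B C pol b -> a =1 b.
Proof.
move=> gen_a gen_b k; elim/ltn_ind: k => k IHk.
by rewrite gen_a gen_b (eq_measured _ _ _ _ IHk).
Qed.

Lemma generated_by_exists (R : realType) (nx nu ny ne : nat) (A : 'M[R]_nx)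
    (B : 'M[R]_(nx, nu)) (C : 'M[R]_(ny + ne, nx)) (Y_a : {set 'I_(ny + ne)})
    (pol : policy R nu Y_a) :
  exists a : nat -> 'cV[R]_(nu + ny), generated_by A B C pol a.
Proof.
pose step n (a : nat -> 'cV[R]_(nu + ny)) k :=
  if k == n then pol n (measured C Y_a (state A B a) n) else a k.
pose upto := fix upto n := if n is m.+1 then step m (upto m) else fun=> 0.
have upto_stable n m k : (k < n <= m)%N -> upto m k = upto n k.
  case/andP=> lt_kn; elim: m => [|m IHm]; first by case: n lt_kn.
  rewrite leq_eqVlt => /predU1P[->//|]; rewrite ltnS => le_nm.
  by rewrite /= {1}/step ltn_eqF ?IHm // (leq_trans lt_kn).
exists (fun k => upto k.+1 k) => k.
rewrite /= /step eqxx; congr (pol k _); apply: eq_measured => s lt_sk.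
by rewrite (upto_stable s.+1) // leqnn.
Qed.

(* Main.v *)
(* If [Y_a] does not separate [u_i] from [t], some sensor [l] outside [Y_a] is
   reached from [u_i].  In the realization whose entries are the structural 0/1
   entries no cancellation occurs, so the transfer coefficient (C A^m B)(l, i)
   is positive for some m.  With m minimal, and k0 the first time at which [u_i]
   is attacked, the output of sensor [l] at time k0 + m + 1 is
   (C A^m B)(l, i) a^(u_i)(k0), which is nonzero.  Hence [Y_a] is a separator
   and ({u_i}, Y_a) is a competitor in the minimum defining the index. *)
Require Import Defs.
From mathcomp Require Import all_boot all_order all_algebra.
From mathcomp Require Import reals constructive_ereal.

Set Implicit Arguments.
Unset Strict Implicit.
Unset Printing Implicit Defensive.

Import Order.TTheory GRing.Theory Num.Theory.
Local Open Scope ring_scope.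

Definition real_mx (R : realType) (m n : nat) (S : 'M[bool]_(m, n)) :
  'M[R]_(m, n) := map_mx (fun b : bool => b%:R) S.

(** This is $C A^k$. Placing each new [A] on the right matches both unfolding the state by one step
    and prepending an edge to a path. *)
Definition mulmx_iter (R : realType) (m n : nat) (C : 'M[R]_(m, n))
  (A : 'M[R]_n) (k : nat) : 'M[R]_(m, n) := iter k (fun M => M *m A) C.

Lemma real_mx_ge0 (R : realType) (m n : nat) (S : 'M[bool]_(m, n)) i j :
  0 <= real_mx R S i j.
Proof. by rewrite mxE ler0n. Qed.

Lemma realization_real_mx (R : realType) (nx nu ny ne : nat)
    (SA : 'M[bool]_nx) (SB : 'M[bool]_(nx, nu)) (SC : 'M[bool]_(ny + ne, nx)) :
  realization SA SB SC (real_mx R SA) (real_mx R SB) (real_mx R SC).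
Proof.
by split=> i j; rewrite mxE; [move/negPf-> | move/negPf-> | move-> | move/negPf->];
  rewrite ?oner_eq0.
Qed.

Lemma mulmx_entry_ge0 (R : realType) (m n p : nat) (M : 'M[R]_(m, n))
    (N : 'M[R]_(n, p)) :
  (forall i j, 0 <= M i j) -> (forall i j, 0 <= N i j) ->
  forall i j, 0 <= (M *m N) i j.
Proof. by move=> M0 N0 i j; rewrite mxE sumr_ge0 // => k _; rewrite mulr_ge0. Qed.

(** Cancellation is excluded here: summand [k] is positive and the others are nonnegative. *)
Lemma mulmx_entry_gt0 (R : realType) (m n p : nat) (M : 'M[R]_(m, n))
    (N : 'M[R]_(n, p)) i j k :
  (forall i j, 0 <= M i j) -> (forall i j, 0 <= N i j) ->
  0 < M i k -> 0 < N k j -> 0 < (M *m N) i j.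
Proof.
move=> M0 N0 Mik Nkj; rewrite mxE (bigD1 k) //= ltr_pwDl ?mulr_gt0 //.
by rewrite sumr_ge0 // => s _; rewrite mulr_ge0.
Qed.

Lemma mulmx_iter_ge0 (R : realType) (m n : nat) (C : 'M[R]_(m, n))
    (A : 'M[R]_n) (k : nat) :
  (forall i j, 0 <= C i j) -> (forall i j, 0 <= A i j) ->
  forall i j, 0 <= mulmx_iter C A k i j.
Proof. by move=> C0 A0; elim: k => // k IHk; apply: mulmx_entry_ge0. Qed.

Lemma mulmx_Ba_supported (R : realType) (nx nu ny ne m : nat)
    (B : 'M[R]_(nx, nu)) (M : 'M[R]_(m, nx)) (i : 'I_nu)
    (Y_a : {set 'I_(ny + ne)}) (a : 'cV[R]_(nu + ny)) l :
  supported i Y_a a ->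
  (M *m (Ba ny B *m a)) l 0 = (M *m B) l i * a (lshift ny i) 0.
Proof.
case=> a0 _; rewrite /Ba -[in LHS](vsubmxK a) mul_row_col mul0mx addr0 mulmxA mxE.
rewrite (bigD1 i) //= big1 ?addr0 => [|j ji]; first by rewrite [usubmx _ _ _]mxE.
by rewrite [usubmx _ _ _]mxE a0 ?mulr0.
Qed.

(** Protected rows of [Da] are zero, and an unprotected row picks out the sensor's own attack entry,
    which is zero outside [Y_a]. *)
Lemma Da_supported (R : realType) (nu ny ne : nat) (i : 'I_nu)
    (Y_a : {set 'I_(ny + ne)}) (a : 'cV[R]_(nu + ny)) l :
  supported i Y_a a -> l \notin Y_a -> (Da R nu ny ne *m a) l 0 = 0.
Proof.
case=> _ a0; rewrite /Da -(vsubmxK a) mul_block_col !mul0mx mul1mx add0r addr0.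
rewrite -[l]splitK; case: (split l) => /= k lY; last by rewrite col_mxEd mxE.
by rewrite col_mxEu mxE a0.
Qed.

(* All terms of the convolution other than the one at k0 vanish: earlier inputs
   are 0 and so are the transfer coefficients of order less than m. *)
Lemma first_response (R : realType) (nx nu ny ne p m k0 : nat)
    (A : 'M[R]_nx) (B : 'M[R]_(nx, nu)) (M : 'M[R]_(p, nx)) (i : 'I_nu)
    (Y_a : {set 'I_(ny + ne)}) (a : nat -> 'cV[R]_(nu + ny)) l :
  (forall k, supported i Y_a (a k)) ->
  (forall k, (k < k0)%N -> a k (lshift ny i) 0 = 0) ->
  (forall s, (s < m)%N -> (mulmx_iter M A s *m B) l i = 0) ->
  (M *m state A B a (k0 + m).+1) l 0 =
  (mulmx_iter M A m *m B) l i * a k0 (lshift ny i) 0.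
Proof.
move=> supp a0 MB0.
(* [N] is arbitrary because the induction replaces it by [N *m A]. *)
have state0 k : (k <= k0)%N -> forall N : 'M[R]_(p, nx),
    (N *m state A B a k) l 0 = 0.
  elim: k => [|k IHk] lk N /=; first by rewrite mulmx0 mxE.
  rewrite mulmxDr mxE mulmxA IHk 1?ltnW // add0r.
  by rewrite (mulmx_Ba_supported _ _ _ (supp k)) a0 ?mulr0.
(* Each time step after [k0] trades one factor [A] of the coefficient; the input entering then has
   coefficient of order [m - s.+1], which is zero by [MB0]. *)
suff step s : (s <= m)%N ->
    (mulmx_iter M A (m - s) *m state A B a (k0 + s).+1) l 0 =
    (mulmx_iter M A m *m B) l i * a k0 (lshift ny i) 0.
  by rewrite -(step m) // subnn.
elim: s => [|s IHs] sm.
  rewrite subn0 addn0 /= mulmxDr mxE mulmxA state0 // add0r.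
  exact: mulmx_Ba_supported (supp k0).
rewrite addnS [state _ _ _ _]/= mulmxDr mxE -[Ba _ _ *m a _]/(Ba ny B *m a _).
rewrite (mulmx_Ba_supported _ _ _ (supp _)) MB0; last first.
  by rewrite ltn_subrL (leq_trans _ sm).
by rewrite mul0r addr0 mulmxA -IHs 1?ltnW // -[(m - s)%N]prednK ?subn_gt0 // subnS.
Qed.

(* Induction along the path starting from [t]; [Q] records, for the head of the
   remaining path, the positive coefficient picked up so far. *)
Lemma connect_transfer_gt0 (R : realType) (nx nu ny ne : nat)
    (SA : 'M[bool]_nx) (SB : 'M[bool]_(nx, nu)) (SC : 'M[bool]_(ny + ne, nx))
    (i : 'I_nu) (Y : {set 'I_(ny + ne)}) :
  connect (remove_nodes (extended_graph SA SB SC) [set ynode nx nu l | l in Y])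
    (unode nx (ny + ne) i) (tnode nx nu (ny + ne)) ->
  exists2 l, l \notin Y &
    exists m, 0 < (mulmx_iter (real_mx R SC) (real_mx R SA) m *m real_mx R SB) l i.
Proof.
set M := mulmx_iter _ _.
have M0 m : forall l j, 0 <= M m l j.
  by apply: mulmx_iter_ge0; apply: real_mx_ge0.
pose Q (v : node nx nu (ny + ne)) := match v with
  | inl (inl (inl j)) => exists2 l, l \notin Y & exists m, 0 < M m l j
  | inl (inl (inr j)) =>
      exists2 l, l \notin Y & exists m, 0 < (M m *m real_mx R SB) l j
  | inl (inr l) => l \notin Y
  | inr _ => True
  end.
case/connectP=> p pth lastp.
suff: Q (unode nx (ny + ne) i) by [].
elim: p (unode _ _ i) pth lastp => [|w p IHp] v /=; first by move=> _ <-.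
case/andP=> /and3P[evw vS _] /IHp{}IHp /IHp.
(* The remaining edges are, in order, x to x (one more [A]), x to y (order 0), u to x (the factor
   [B]) and y to t (the sensor was not removed). *)
case: v w evw vS {IHp} => [[[j|j]|l]|?] [[[j'|j']|l']|?] //= evw vS.
- case=> l lY [m ml]; exists l => //; exists m.+1.
  by apply: (mulmx_entry_gt0 (k := j')); rewrite ?mxE ?evw //; apply: real_mx_ge0.
- by move=> l'Y; exists l' => //; exists 0; rewrite mxE evw.
- case=> l lY [m ml]; exists l => //; exists m.
  by apply: (mulmx_entry_gt0 (k := j')); rewrite ?mxE ?evw //; apply: real_mx_ge0.
- by move=> _; apply: contra vS => lY; apply/imsetP; exists l.
Qed.

Lemma type3_admissible (R : realType) (nx nu ny ne : nat)
    (SA : 'M[bool]_nx) (SB : 'M[bool]_(nx, nu)) (SC : 'M[bool]_(ny + ne, nx))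
    (i : 'I_nu) (Y_a : {set 'I_(ny + ne)}) :
  (forall l, l \in Y_a -> unprotected l) ->
  type3_can_attack R SA SB SC i Y_a -> admissible SA SB SC i ([set i], Y_a).
Proof.
move=> hY [pol supp /(_ _ _ _ (realization_real_mx R SA SB SC))].
case=> a [gen /ex_minnP[k0 ak0 k0_min] [_ y0]].
rewrite /admissible set11; apply/andP; split=> //; apply/andP; split.
  by apply/forall_inP.
have -> : [set j | [exists k in [set i] :\ i, SB j k]] = set0.
  by apply/setP=> j; rewrite !inE setDv; apply/existsP=> -[k]; rewrite inE.
rewrite imset0 set0U /vertex_separator.
apply/and3P; split; try by apply/imsetP=> -[].
apply/negP=> /(connect_transfer_gt0 R)[l lY exm].
(* With [!= 0] in place of [0 <], minimality of [m] makes all coefficients of lower order exactly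
   zero. *)
have{exm} : exists m,
    (mulmx_iter (real_mx R SC) (real_mx R SA) m *m real_mx R SB) l i != 0.
  by case: exm => m m0; exists m; rewrite gt_eqF.
case/ex_minnP=> m m0 m_min.
have suppa k : supported i Y_a (a k) by rewrite gen.
have /matrixP/(_ l 0) := y0 (k0 + m).+1.
rewrite /output [LHS]mxE (Da_supported (suppa _) lY) addr0 [RHS]mxE.
rewrite (first_response (m := m) (k0 := k0) suppa).
- by apply/eqP; rewrite mulf_neq0.
- by move=> k; rewrite ltnNge; apply: contraNeq => /k0_min.
- by move=> s; rewrite ltnNge; apply: contraNeq => /m_min.
Qed.

Lemma robust_index_le (R : realType) (nx nu ny ne : nat)
    (SA : 'M[bool]_nx) (SB : 'M[bool]_(nx, nu)) (SC : 'M[bool]_(ny + ne, nx))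
    (i : 'I_nu) P :
  admissible SA SB SC i P ->
  (robust_index R SA SB SC i <= ((#|P.1| + #|P.2|)%N%:R)%:E)%E.
Proof. by move=> adm; rewrite /robust_index; apply: bigmin_le_cond. Qed.

Theorem proposition6 (R : realType) (nx nu ny ne : nat)
    (SA : 'M[bool]_nx) (SB : 'M[bool]_(nx, nu)) (SC : 'M[bool]_(ny + ne, nx))
    (hS : structural_assumption R SB SC)
    (i : 'I_nu) (Y_a : {set 'I_(ny + ne)})
    (hY : forall l, l \in Y_a -> unprotected l) :
  (type3_can_attack R SA SB SC i Y_a ->
     (robust_index R SA SB SC i - 1%:E <= (#|Y_a|%:R)%:E)%E) /\
  (robust_index R SA SB SC i = +oo%E ->
     ~ type3_can_attack R SA SB SC i Y_a).
Proof.
(* The 1 counts [u_i] itself. This finite bound yields the inequality and also rules out the value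
   [+oo]. *)
have index_le : type3_can_attack R SA SB SC i Y_a ->
    (robust_index R SA SB SC i <= ((1 + #|Y_a|)%N%:R)%:E)%E.
  move=> /(type3_admissible hY)/(robust_index_le R).
  by rewrite cards1.
split=> [/index_le|index_oo /index_le]; last by rewrite index_oo leye_eq.
by rewrite leeBlDr // -EFinD natrD addrC.
Qed.
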